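(* Let $\mathcal{H}$ be a complex Hilbert space, let $T,S\in\mathcal{B}(\mathcal{H})$, let $q\in(0,1]$, and let $n$ be a positive integer. Let $\mathbb{P}$ be the $n\times n$ tridiagonal operator matrix $$\mathbb{P}=\begin{bmatrix} T & S & O & \cdots & O\\ S & T & S & \cdots & \vdots\\ O & S & T & \ddots & O\\ \vdots & \vdots & \ddots & \ddots & S\\ O & O & \cdots & S & T\end{bmatrix}$$ acting on $\bigoplus_{j=1}^n\mathcal{H}$ (every diagonal entry is $T$, every entry immediately above or below the diagonal is $S$, all other entries are $O$). Then $$\max_{1\le k\le n} w_q\left(T+\left(2\cos\frac{k\pi}{n+1}\right)S\right)\le w_q(\mathbb{P})\le \frac{q+2\sqrt{1-q^2}}{q}\max_{1\le k\le n} w_q\left(T+\left(2\cos\frac{k\pi}{n+1}\right)S\right).$$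
   Context: $\mathcal{B}(\mathcal{K})$ denotes the bounded linear operators on a complex Hilbert space $\mathcal{K}$; $O$ is the zero operator. An $n\times n$ matrix $[S_{ij}]$ with entries in $\mathcal{B}(\mathcal{H})$ acts on $\bigoplus_{j=1}^n\mathcal{H}$ (with the direct-sum inner product) by $(x_1,\dots,x_n)\mapsto(\sum_j S_{1j}x_j,\dots,\sum_j S_{nj}x_j)$. For $A\in\mathcal{B}(\mathcal{K})$ and a scalar $q$ with $|q|\le 1$, the $q$-numerical range is $W_q(A)=\{\langle Ax,y\rangle: x,y\in\mathcal{K},\ \|x\|=\|y\|=1,\ \langle x,y\rangle=q\}$ and the $q$-numerical radius is $w_q(A)=\sup\{|z|: z\in W_q(A)\}$. In the degenerate case $\dim\mathcal{K}=1$, where $A$ is a scalar $c$ and $W_q(A)$ is empty for $0<q<1$, the convention is $w_q(A)=q|c|$. *)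

(* Defs.v *)
From HB Require Import structures.
From mathcomp Require Import all_boot all_order all_algebra.
From mathcomp Require Import sesquilinear.
From mathcomp Require Import complex.
From mathcomp Require Import boolp classical_sets reals topology normedtype trigo.

Set Implicit Arguments.
Unset Strict Implicit.
Unset Printing Implicit Defensive.

Import Order.TTheory GRing.Theory Num.Theory.
Import numFieldNormedType.Exports.

Local Open Scope classical_set_scope.
Local Open Scope ring_scope.
Local Open Scope complex_scope.

(* The inner product is linear in its first argument. *)
HB.mixin Record NormedModule_hasInner (R : realType) V
    & NormedModule R[i] V := {
  inner : {dot V for @Num.conj R[i]} ;
  sqr_norm_inner : forall x : V, `|x| ^+ 2 = inner x x
}.

#[short(type="hilbertType")]
HB.structure Definition Hilbert (R : realType) :=
  {V of CompleteNormedModule R[i] V & NormedModule_hasInner R V}.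

Section dot_norm.
Variables (C : numClosedFieldType) (U : lmodType C) (f : {dot U for @Num.conj C}).

Lemma dot_CauchySchwarz (u v : U) : `|f u v| ^+ 2 <= f u u * f v v.
Proof.
have [->|v0] := eqVneq v 0; first by rewrite !linear0r normr0 expr0n mulr0.
have fv0 : f v v != 0 by rewrite dnorm_eq0.
pose a := f u v / f v v; pose u1 := u - a *: v.
have ou : f u1 v = 0.
  by rewrite /u1 linearBl/= linearZl_LR/= divfK// subrr.
have -> : f u u = f u1 u1 + `|a| ^+ 2 * f v v.
  rewrite -dnormZ -[in LHS](subrK (a *: v) u) -/u1.
  by rewrite hnormDd//= linearZr_LR/= ou mulr0.
rewrite mulrDl -mulrA -expr2 normrM normfV (ger0_norm (dnorm_ge0 f v)).
by rewrite exprMn exprVn divfK ?expf_neq0// lerDr mulr_ge0// dnorm_ge0.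
Qed.

Lemma dot_triangle (u v : U) :
  sqrtC (f (u + v) (u + v)) <= sqrtC (f u u) + sqrtC (f v v).
Proof.
rewrite -(@ler_pXn2r _ 2)// ?nnegrE ?addr_ge0 ?sqrtC_ge0 ?dnorm_ge0//.
rewrite sqrrD !sqrtCK dnormD [leRHS]addrAC lerD2l.
have CS : `|f u v| <= sqrtC (f u u) * sqrtC (f v v).
  rewrite -(@ler_pXn2r _ 2)// ?nnegrE ?mulr_ge0 ?sqrtC_ge0 ?dnorm_ge0//.
  by rewrite exprMn !sqrtCK dot_CauchySchwarz.
have -> : f u v + (f u v)^* = 'Re (f u v) *+ 2.
  by rewrite -[LHS]mulr1 ReE -mulr_natr divfK ?pnatr_eq0 ?mulr1.
rewrite lerMn2r/=; apply: le_trans CS; exact: leif_Re_Creal.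
Qed.

End dot_norm.

(* The Hilbert direct sum of n copies of H; a separate name, so that the
   norm below is the l2 norm and not one inherited from finite functions. *)
Definition hsum (n : nat) (H : Type) := {ffun 'I_n -> H}.

Section hsum.
Variables (R : realType) (n : nat) (H : hilbertType R).

HB.instance Definition _ := GRing.Lmodule.copy (hsum n H) {ffun 'I_n -> H}.

Definition hsum_inner (x y : hsum n H) : R[i] := \sum_(i < n) inner (x i) (y i).

Fact hsum_inner_bilinear :
  bilinear_for *%R (@Num.conj R[i] \; *%R) hsum_inner.
Proof.
split=> [y a x x'|x a y y']; rewrite /hsum_inner /= mulr_sumr -big_split/=;
  apply: eq_bigr => i _; rewrite !ffunE.
- by rewrite linearDl/= linearZl_LR.
- by rewrite linearDr/= linearZr_LR.
Qed.

HB.instance Definition _ := @bilinear_isBilinear.Build _ _ _ _ _ _ hsum_inner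
  hsum_inner_bilinear.

Fact hsum_inner_hermitian (x y : hsum n H) :
  hsum_inner x y = (-1) ^+ false * Num.conj (hsum_inner y x).
Proof.
rewrite mul1r rmorph_sum; apply: eq_bigr => i _.
by rewrite hermC/= mul1r.
Qed.

HB.instance Definition _ := @isHermitianSesquilinear.Build _ _ _ _ hsum_inner
  hsum_inner_hermitian.

Fact hsum_inner_gt0 (x : hsum n H) : x != 0 -> 0 < hsum_inner x x.
Proof.
move=> x0; rewrite lt_def sumr_ge0 ?andbT; last by move=> i _; exact: dnorm_ge0.
apply: contra_neq x0 => /psumr_eq0P x0; apply/ffunP => i; rewrite ffunE.
apply/eqP; rewrite -(dnorm_eq0 inner) x0// => j _; exact: dnorm_ge0.
Qed.

HB.instance Definition _ := @isDotProduct.Build _ _ hsum_inner hsum_inner_gt0.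

Definition hsum_norm (x : hsum n H) : R[i] := sqrtC (hsum_inner x x).

Fact hsum_normZ a x : hsum_norm (a *: x) = `|a| * hsum_norm x.
Proof.
rewrite /hsum_norm dnormZ sqrtCM ?nnegrE ?exprn_ge0 ?dnorm_ge0//.
by rewrite sqrCK.
Qed.

Fact hsum_norm_eq0 x : hsum_norm x = 0 -> x = 0.
Proof. by move/eqP; rewrite sqrtC_eq0 dnorm_eq0 => /eqP. Qed.

HB.instance Definition _ := @Lmodule_isNormed.Build _ (hsum n H) hsum_norm
  (dot_triangle hsum_inner) hsum_normZ hsum_norm_eq0.

Fact hsum_sqr_norm (x : hsum n H) : `|x| ^+ 2 = hsum_inner x x.
Proof. exact: sqrtCK. Qed.

Lemma hsum_norm_coord (x : hsum n H) i : `|x i| <= `|x|.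
Proof.
rewrite -(@ler_pXn2r _ 2)// ?nnegrE// hsum_sqr_norm sqr_norm_inner.
by rewrite /hsum_inner (bigD1 i)//= lerDl sumr_ge0// => j _; exact: dnorm_ge0.
Qed.

Lemma hsum_norm_le_sum (x : hsum n H) : `|x| <= \sum_(i < n) `|x i|.
Proof.
rewrite -(@ler_pXn2r _ 2)// ?nnegrE ?sumr_ge0// hsum_sqr_norm expr2 mulr_suml.
apply: ler_sum => i _; rewrite -sqr_norm_inner expr2 ler_wpM2l//.
by rewrite (bigD1 i)//= lerDl sumr_ge0.
Qed.

Fact hsum_complete (F : set_system (hsum n H)) :
  ProperFilter F -> cauchy F -> cvg F.
Proof.
move=> FF Fc.
have /(_ _) /cauchy_cvg cvF : forall i, cauchy ((fun x : hsum n H => x i) @ F).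
  move=> i; apply/cauchy_ballP => e e0.
  rewrite near_map2.
  move/cauchy_ballP : Fc => /(_ e e0); apply: filterS => -[x y] /=.
  rewrite -!ball_normE /ball_/=; apply: le_lt_trans.
  by have := hsum_norm_coord (x - y) i; rewrite !ffunE.
pose l : hsum n H := [ffun i => lim ((fun x : hsum n H => x i) @ F)].
apply/cvg_ex; exists l; apply/cvgrPdist_le => e e0.
have e'0 : 0 < e / n.+1%:R by rewrite divr_gt0.
have : F [set x : hsum n H | forall i, `|l i - x i| <= e / n.+1%:R].
  apply: filter_forall => i; rewrite ffunE.
  by move/cvgrPdist_le : (cvF i) => /(_ _ e'0).
apply: filterS => x lx; apply: le_trans (hsum_norm_le_sum _) _.
apply: (@le_trans _ _ (\sum_(i < n) (e / n.+1%:R))).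
  by apply: ler_sum => i _; have := lx i; rewrite !ffunE.
rewrite sumr_const card_ord -[leLHS]mulr_natr -mulrA ler_piMr ?ltW//.
by rewrite ltr_pdivrMl// mulr1 ltr_nat.
Qed.

HB.instance Definition _ := Uniform_isComplete.Build (hsum n H) hsum_complete.

HB.instance Definition _ := @NormedModule_hasInner.Build _ (hsum n H)
  hsum_inner hsum_sqr_norm.

End hsum.

Section opmx.
Variables (R : realType) (n : nat) (H : hilbertType R).
Implicit Type M : 'M[{linear H -> H}]_n.

Definition opmx M (x : hsum n H) : hsum n H :=
  [ffun i => \sum_(j < n) M i j (x j)].

Fact opmx_linear M : linear (opmx M).
Proof.
move=> a x y; apply/ffunP => i; rewrite !ffunE scaler_sumr -big_split/=.
by apply: eq_bigr => j _; rewrite !ffunE linearP.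
Qed.

HB.instance Definition _ M :=
  @GRing.isLinear.Build _ _ _ _ (opmx M) (opmx_linear M).

Definition tridiag (T S : {linear H -> H}) : 'M[{linear H -> H}]_n :=
  \matrix_(i, j) if i == j then T
                 else if (i.+1 == j) || (j.+1 == i) then S
                 else \0.

End opmx.
Arguments tridiag {R} n {H}.

Section bounded.
Variables (R : realType) (n : nat) (H : hilbertType R).

Lemma opmx_bounded (M : 'M[{linear H -> H}]_n) :
  (forall i j, bounded_near (M i j) (nbhs (0 : H))) ->
  bounded_near (opmx M) (nbhs (0 : hsum n H)).
Proof.
move=> Mb; apply/linear_boundedP.
have /pinfty_ex_gt0[r r0 Mr] : \forall r \near +oo, forall i j x,
    `|M i j x| <= r * `|x|.
  by do 2 apply: filter_forall => ?; apply/linear_boundedP.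
have bound x : `|opmx M x| <= (n%:R * n%:R * r) * `|x|.
  apply: le_trans (hsum_norm_le_sum _) _.
  have -> : n%:R * n%:R * r * `|x| = \sum_(i < n) \sum_(j < n) r * `|x|.
    rewrite !sumr_const !card_ord.
    by rewrite -[RHS]mulr_natl -[X in _ = _ * X]mulr_natl !mulrA.
  apply: ler_sum => i _; rewrite ffunE; apply: le_trans (ler_norm_sum _ _ _) _.
  apply: ler_sum => j _; apply: le_trans (Mr i j _) _.
  by rewrite ler_wpM2l ?(ltW r0)// hsum_norm_coord.
near=> s => x; apply: le_trans (bound x) _; rewrite ler_wpM2r//.
near: s; apply: nbhs_pinfty_ge; rewrite !realM ?realn//.
exact: gtr0_real.
Unshelve. all: by end_near. Qed.

End bounded.

Section qnumradius.
Variables (R : realType) (K : hilbertType R).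

Definition qnumrange (q : R[i]) (A : {linear K -> K}) : set R[i] :=
  [set z | exists x y : K,
    [/\ `|x| = 1, `|y| = 1, inner x y = q & z = inner (A x) y]].

Definition dim1 : Prop :=
  exists2 e : K, e != 0 & forall x : K, exists c : R[i], x = c *: e.

(* If dim K = 1 and 0 < q < 1, then W_q(A) is empty; A is then a scalar c and
   the radius is q|c| by convention. *)
Definition qnummoduli (q : R) (A : {linear K -> K}) : set R :=
  if `[< dim1 /\ 0 < q < 1 >]
  then [set r | exists2 c : R[i], A =1 *:%R c & r%:C = q%:C * `|c|]
  else [set r | exists2 z, qnumrange q%:C A z & r%:C = `|z|].

(* [sup] is the real supremum: it is 0 on the empty set, which occurs here
   only for K = 0 (if 0 < q <= 1), and the set is bounded if A is. *)
Definition qnumradius (q : R) (A : {linear K -> K}) : R := sup (qnummoduli q A).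

(* Hence 0 is a harmless neutral element for finite maxima of radii. *)
Lemma qnumradius_ge0 q A : 0 <= qnumradius q A.
Proof.
have ge0 r : qnummoduli q A r -> 0 <= r.
  rewrite /qnummoduli; case: ifPn => [/asboolP[_ /andP[q0 _]]|_] [z _ rE];
    rewrite -(@lecR R) rE ?normr_ge0//.
  exact: mulr_ge0 (etrans (lecR 0 q) (ltW q0)) (normr_ge0 _).
rewrite /qnumradius; have [supA|/sup_out->//] := pselect (has_sup (qnummoduli q A)).
have [r Ar] := supA.1.
by apply: le_trans (ge0 r Ar) _; exact: sup_upper_bound.
Qed.

End qnumradius.

(* Main.v *)
Require Import Defs.
From HB Require Import structures.
From mathcomp Require Import all_boot all_order all_algebra.
From mathcomp Require Import sesquilinear.
From mathcomp Require Import complex.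
From mathcomp Require Import boolp classical_sets reals topology normedtype trigo.
From mathcomp Require Import ring.

Set Implicit Arguments.
Unset Strict Implicit.
Unset Printing Implicit Defensive.

Import Order.TTheory GRing.Theory Num.Theory.
Import numFieldNormedType.Exports.

Local Open Scope classical_set_scope.
Local Open Scope ring_scope.
Local Open Scope complex_scope.

(** The scalar tridiagonal matrix with zero diagonal and ones next to it, that
    is, the adjacency matrix of a path on n vertices, has the orthogonal
    eigenvectors (sin (j k pi / (n + 1)))_j with eigenvalues
    2 cos (k pi / (n + 1)).  Tensoring the normalised eigenvectors with H gives n
    pairwise orthogonal isometric copies of H in the direct sum, which fill it
    ([mode_decomposition]) and on which the operator matrix acts as
    A_k = T + 2 cos (k pi / (n + 1)) S ([tridiag_mode]).  The operator matrix is
    thus unitarily equivalent to the direct sum of the A_k.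

    The lower bound expresses that w_q does not decrease when an operator is
    embedded isometrically as the restriction of another one to an invariant
    subspace ([qnumradius_isometry]).

    The upper bound passes through the ordinary numerical radius w, i.e. the best
    constant in |<A v, v>| <= w |v|^2.  The constant w is well behaved under
    orthogonal sums, since there both sides add up over the summands.  The two
    radii are comparable:

    - q w(A) <= w_q(A) ([quadratic_le_qnumradius]), for if z is orthogonal to the
      unit vector u and |z|^2 = 1 - q^2, then q u + z and q u - z are both
      admissible partners of u, and their average is q u;

    - w_q(A) <= (q + 2 sqrt (1 - q^2)) w(A) ([qnumradius_le_of_quadratic]), for
      an admissible y is q x plus a vector of norm sqrt (1 - q^2), and by
      polarization |<A x, p>| <= 2 w(A) |x| |p|.

    The first comparison, applied to each A_k, gives w <= (max w_q(A_k)) / q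
    for the operator matrix; the second one then gives the upper bound. *)

(** * Bounded operators, the inner product and polarization *)

Section InnerProduct.
Variables (R : realType) (K : hilbertType R).
Implicit Types (A : {linear K -> K}) (x y u v : K).

Lemma bounded_nearP A :
  bounded_near A (nbhs (0 : K)) <->
  exists2 r : R, 0 <= r & forall x, `|A x| <= r%:C * `|x|.
Proof.
rewrite linear_boundedP; split=> [/pinfty_ex_gt0[r r0 rA]|[r r0 rA]].
  have rE := RRe_real (gtr0_real r0).
  by exists (complex.Re r); [rewrite -lecR rE ltW|move=> x; rewrite rE].
near=> s => x; apply: le_trans (rA x) _; rewrite ler_wpM2r//.
by near: s; apply: nbhs_pinfty_ge; rewrite ger0_real// ler0c.
Unshelve. all: by end_near. Qed.

Lemma bounded_near_addZ (A B : {linear K -> K}) (a : R[i]) :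
  bounded_near A (nbhs (0 : K)) -> bounded_near B (nbhs (0 : K)) ->
  bounded_near (A \+ a \*: B) (nbhs (0 : K)).
Proof.
move=> /bounded_nearP[r r0 rA] /bounded_nearP[s s0 sB].
have aE := RRe_real (normr_real a).
apply/bounded_nearP; exists (r + complex.Re `|a| * s).
  by rewrite addr_ge0// mulr_ge0// -ler0c aE.
move=> x; apply: le_trans (ler_normD _ _) _.
rewrite rmorphD rmorphM/= mulrDl lerD//= normrZ aE -mulrA.
by rewrite ler_wpM2l.
Qed.

Lemma inner_sym x y : inner x y = Num.conj (inner y x).
Proof. by rewrite hermC/= mul1r. Qed.

Lemma innerZl a x y : inner (a *: x) y = a * inner x y.
Proof. exact: linearZl_LR. Qed.

Lemma innerZr a x y : inner x (a *: y) = Num.conj a * inner x y.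
Proof. by rewrite linearZr_LR. Qed.

Lemma conj_real (r : R) : Num.conj r%:C = r%:C.
Proof. exact: conjc_real. Qed.

Lemma innerZr_real (r : R) x y : inner x (r%:C *: y) = r%:C * inner x y.
Proof. by rewrite innerZr conj_real. Qed.

Lemma norm_inner_le x y : `|inner x y| <= `|x| * `|y|.
Proof.
rewrite -(@ler_pXn2r _ 2)// ?nnegrE ?mulr_ge0//.
by rewrite exprMn !sqr_norm_inner dot_CauchySchwarz.
Qed.

Lemma parallelogram x y :
  `|x + y| ^+ 2 + `|x - y| ^+ 2 = 2 * (`|x| ^+ 2 + `|y| ^+ 2).
Proof. by rewrite !sqr_norm_inner dnormD dnormB; ring. Qed.

(** The directions x + y and x - y alone give <A x, y> + <A y, x>; the two
    imaginary directions cancel the second term. *)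
Lemma polarization A x y :
  4 * inner (A x) y =
    inner (A (x + y)) (x + y) - inner (A (x - y)) (x - y)
    + 'i%R * (inner (A (x + 'i%R *: y)) (x + 'i%R *: y)
              - inner (A (x - 'i%R *: y)) (x - 'i%R *: y)).
Proof.
have expand c : inner (A (x + c *: y)) (x + c *: y) =
    inner (A x) x + c * inner (A y) x + Num.conj c * inner (A x) y
    + c * Num.conj c * inner (A y) y.
  rewrite [A _]linearD [A (c *: y)]linearZ/= linearDl/= !linearDr/= !innerZl !innerZr.
  ring.
rewrite -[y in x + y]scale1r -[y in x - y]scale1r -!scaleNr !expand.
rewrite !rmorphN !rmorph1 /= !conjCi.
have := @sqrCi R[i]; set i := 'i%R => i2.
by ring: i2.
Qed.

(** The quantitative content of the bound of the operator norm by twice the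
    numerical radius: polarization and the parallelogram law give the arithmetic
    mean of the squared norms, and rescaling turns it into the product. *)
Lemma bilinear_le_of_quadratic A (w : R) :
  (forall v, `|inner (A v) v| <= w%:C * `|v| ^+ 2) ->
  forall x y, `|inner (A x) y| <= 2 * w%:C * (`|x| * `|y|).
Proof.
move=> wA x y.
have half u v : `|inner (A u) v| <= w%:C * (`|u| ^+ 2 + `|v| ^+ 2).
  rewrite -(@ler_pM2l _ 4)// -[X in X * _](@ger0_norm _ 4)// -normrM polarization.
  apply: le_trans (ler_normD _ _) _; rewrite normrM normCi mul1r.
  have -> : 4 * (w%:C * (`|u| ^+ 2 + `|v| ^+ 2)) =
     w%:C * `|u + v| ^+ 2 + w%:C * `|u - v| ^+ 2
     + (w%:C * `|u + 'i%R *: v| ^+ 2 + w%:C * `|u - 'i%R *: v| ^+ 2).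
    by rewrite -!mulrDr !parallelogram normrZ normCi; ring.
  by apply: lerD; apply: le_trans (ler_normB _ _) _; exact: lerD.
have [->|x0] := eqVneq x 0; first by rewrite linear0 linear0l !normr0 mul0r mulr0.
have [->|y0] := eqVneq y 0; first by rewrite linear0r !normr0 !mulr0.
(* at unit vectors the factor |u|^2 + |v|^2 is the constant 2 of the bound *)
have := half (`|x|^-1 *: x) (`|y|^-1 *: y).
rewrite [A _]linearZ/= innerZl innerZr !normrM !normrZ !norm_conjC !normfV !normr_id.
rewrite !mulVf ?normr_eq0// expr1n mulrA -invfM mulrC ler_pdivrMr; last first.
  by rewrite mulr_gt0// normr_gt0.
by rewrite [w%:C * _]mulrC.
Qed.

End InnerProduct.

(** * The q-numerical radius and the quadratic form *)

Section QNumericalRadius.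
Variables (R : realType) (K : hilbertType R).
Implicit Types (A : {linear K -> K}) (x y u v : K).

Lemma real_normE (z : R[i]) : exists r : R, r%:C = `|z|.
Proof. by exists (complex.Re `|z|); exact: RRe_real (normr_real z). Qed.

Lemma qnummoduli_has_ubound q A :
  bounded_near A (nbhs (0 : K)) -> has_ubound (qnummoduli q A).
Proof.
move=> /bounded_nearP[r r0 rA]; rewrite /qnummoduli.
case: ifPn => [/asboolP[[e e0 _] /andP[q0 _]]|_].
- exists (q * r) => s [c cA sE]; rewrite -lecR sE rmorphM/= ler_wpM2l//.
    by rewrite ler0c ltW.
  have := rA e; rewrite cA normrZ ler_pM2r//.
  by rewrite normr_gt0.
- exists r => s [z [x [y [x1 y1 _ ->]]] sE]; rewrite -lecR sE.
  apply: le_trans (norm_inner_le _ _) _; rewrite y1 mulr1.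
  by have := rA x; rewrite x1 mulr1.
Qed.

Lemma le_qnumradius q A r :
  bounded_near A (nbhs (0 : K)) -> qnummoduli q A r -> r <= qnumradius q A.
Proof. by move=> /(qnummoduli_has_ubound q) ub Ar; exact: ub_le_sup. Qed.

Lemma qnumradius_le q A b :
  0 <= b -> (forall r, qnummoduli q A r -> r <= b) -> qnumradius q A <= b.
Proof.
move=> b0 Ab; rewrite /qnumradius.
have [->|] := eqVneq (qnummoduli q A) set0; first by rewrite sup0.
by move=> /set0P A0; exact: ge_sup.
Qed.

Lemma dim1_scalar A : dim1 K -> exists c : R[i], A =1 *:%R c.
Proof.
move=> [e e0 eK]; have [c cE] := eK (A e); exists c => x.
by have [a ->] := eK x; rewrite linearZ/= cE !scalerA mulrC.
Qed.

Lemma not_dim1_orthogonal u :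
  u != 0 -> ~ dim1 K -> exists2 p : K, p != 0 & inner p u = 0.
Proof.
move=> u0 K1; apply: contrapT => no; apply: K1; exists u => // x.
have uu : inner u u != 0 by rewrite dnorm_eq0.
exists (inner x u / inner u u); apply/eqP; rewrite -subr_eq0; apply/eqP.
apply: contrapT => /eqP p0; apply: no; exists (x - (inner x u / inner u u) *: u) => //.
by rewrite linearBl/= innerZl divfK// subrr.
Qed.

(** The difference between a unit vector y with <u, y> = q and its component q u.
    It must have norm sqrt (1 - q^2), so it exists exactly outside the degenerate
    case in which the q-numerical range is empty. *)
Lemma exists_orthogonal_residue (q : R) u : 0 < q <= 1 -> `|u| = 1 ->
  ~ (dim1 K /\ 0 < q < 1) ->
  exists2 z : K, inner z u = 0 & `|z| ^+ 2 = 1 - q%:C ^+ 2.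
Proof.
move=> /andP[q0 q1] u1 nd.
have [qE|qn1] := eqVneq q 1.
  by exists 0; rewrite ?linear0l// qE normr0 expr0n/= expr1n subrr.
have u0 : u != 0 by rewrite -normr_eq0 u1 oner_eq0.
have [|p p0 pu] := not_dim1_orthogonal u0.
  by move=> d; apply: nd; split=> //; rewrite q0 lt_neqAle qn1.
exists (((Num.sqrt (1 - q ^+ 2))%:C / `|p|) *: p).
  by rewrite innerZl pu mulr0.
have s0 : 0 <= 1 - q ^+ 2 by rewrite subr_ge0 expr_le1// ltW.
rewrite normrZ normrM normfV normr_id divfK ?normr_eq0//.
by rewrite ger0_norm ?ler0c ?sqrtr_ge0// -rmorphXn/= sqr_sqrtr// rmorphB/= rmorphXn.
Qed.

(** The inequality q w(A) <= w_q(A).  In the degenerate case of dimension one it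
    holds with equality, by the convention that defines the radius there. *)
Lemma quadratic_le_qnumradius q A u : 0 < q <= 1 ->
  bounded_near A (nbhs (0 : K)) ->
  q%:C * `|inner (A u) u| <= (qnumradius q A)%:C * `|u| ^+ 2.
Proof.
move=> /andP[q0 q1] Ab; have qC0 : 0 <= q%:C by rewrite ler0c ltW.
have unit_case v : `|v| = 1 -> q%:C * `|inner (A v) v| <= (qnumradius q A)%:C.
  move=> v1; have vv : inner v v = 1 by rewrite -sqr_norm_inner v1 expr1n.
  have [d1|nd] := pselect (dim1 K /\ 0 < q < 1).
    have [c cA] := dim1_scalar A d1.1; have [r rc] := real_normE c.
    rewrite cA innerZl vv mulr1 -rc -rmorphM/= lecR.
    apply: le_qnumradius Ab _; rewrite /qnummoduli asboolT//.
    by exists c; rewrite // -rc rmorphM.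
  have le z : inner z v = 0 -> `|z| ^+ 2 = 1 - q%:C ^+ 2 ->
      `|inner (A v) (q%:C *: v + z)| <= (qnumradius q A)%:C.
    move=> zv z1; have vz : inner v z = 0 by rewrite inner_sym zv rmorph0.
    have [r rE] := real_normE (inner (A v) (q%:C *: v + z)).
    rewrite -rE lecR; apply: le_qnumradius Ab _; rewrite /qnummoduli asboolF//.
    exists (inner (A v) (q%:C *: v + z)) => //.
    exists v, (q%:C *: v + z); split=> //.
      apply/eqP; rewrite -(@eqrXn2 _ 2)// expr1n sqr_norm_inner hnormDd/=.
        by rewrite dnormZ vv -sqr_norm_inner z1 ger0_norm// mulr1 addrC subrK.
      by rewrite innerZl vz mulr0.
    by rewrite linearDr/= vz addr0 innerZr_real vv mulr1.
  have [|z zv z1] := exists_orthogonal_residue _ v1 nd; first by rewrite q0.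
  (* averaging over q v + z and q v - z cancels the uncontrolled <A v, z> *)
  rewrite -(@ler_pM2l _ 2)// -[X in X * (_ * _)](@ger0_norm _ 2)//.
  rewrite -[q%:C](@ger0_norm _ q%:C)// -!normrM.
  have -> : 2 * (q%:C * inner (A v) v) =
      inner (A v) (q%:C *: v + z) + inner (A v) (q%:C *: v - z).
    by rewrite linearDr/= linearBr/= !innerZr_real; ring.
  apply: le_trans (ler_normD _ _) _; rewrite mulr_natl mulr2n lerD ?le//.
    by rewrite linearNl/= zv oppr0.
  by rewrite normrN.
have [->|u0] := eqVneq u 0; first by rewrite linear0r !normr0 expr0n !mulr0.
have := unit_case (`|u|^-1 *: u).
rewrite normrZ normfV normr_id mulVf ?normr_eq0// => /(_ erefl).
rewrite [A _]linearZ/= innerZl innerZr !normrM norm_conjC !normfV !normr_id.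
rewrite mulrA -invfM [X in q%:C * X]mulrC mulrA ler_pdivrMr// -?expr2//.
by rewrite exprn_gt0// normr_gt0.
Qed.

(** Splitting y = q x + p bounds <A x, y> by q w plus the polarization bound
    2 w |p|, where |p| = sqrt (1 - q^2). *)
Lemma qnumradius_le_of_quadratic q A (w : R) : 0 < q <= 1 -> 0 <= w ->
  (forall v, `|inner (A v) v| <= w%:C * `|v| ^+ 2) ->
  qnumradius q A <= (q + 2 * Num.sqrt (1 - q ^+ 2)) * w.
Proof.
move=> /andP[q0 q1] w0 wA.
have s0 : 0 <= 1 - q ^+ 2 by rewrite subr_ge0 expr_le1// ltW.
have qC0 : 0 <= q%:C by rewrite ler0c ltW.
apply: qnumradius_le => [|r]; first
  by rewrite mulr_ge0// addr_ge0 ?mulr_ge0 ?sqrtr_ge0// ltW.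
rewrite /qnummoduli; case: ifPn => [/asboolP[[e e0 _] _] [c cA rE]|_].
- apply: (@le_trans _ _ (q * w)); last by rewrite ler_wpM2r// lerDl mulr_ge0 ?sqrtr_ge0.
  rewrite -lecR rE rmorphM/= ler_wpM2l//.
  have := wA e; rewrite cA innerZl -sqr_norm_inner normrM.
  by rewrite [`|_ ^+ 2|]ger0_norm ?exprn_ge0// ler_pM2r// exprn_gt0// normr_gt0.
- move=> [z [x [y [x1 y1 xy ->]]] rE]; rewrite -lecR rE.
  have xx : inner x x = 1 by rewrite -sqr_norm_inner x1 expr1n.
  pose p := y - q%:C *: x.
  have pE : `|p| = (Num.sqrt (1 - q ^+ 2))%:C.
    apply/eqP; rewrite -(@eqrXn2 _ 2)// ?ler0c ?sqrtr_ge0//.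
    rewrite -rmorphXn/= sqr_sqrtr// sqr_norm_inner dnormB dnormZ xx -sqr_norm_inner y1.
    rewrite innerZr_real inner_sym xy conj_real (ger0_norm qC0) rmorphB/= rmorphXn/=.
    by rewrite rmorphM/= !conj_real rmorph1; apply/eqP; ring.
  have -> : y = q%:C *: x + p by rewrite addrC subrK.
  rewrite linearDr/= innerZr_real; apply: le_trans (ler_normD _ _) _.
  rewrite mulrDl rmorphD/= lerD//.
    rewrite normrM (ger0_norm qC0) rmorphM/= ler_wpM2l//.
    by have := wA x; rewrite x1 expr1n mulr1.
  apply: le_trans (bilinear_le_of_quadratic wA _ _) _.
  by rewrite x1 mul1r pE !rmorphM/= rmorph_nat mulrAC.
Qed.

End QNumericalRadius.

(** An isometric intertwiner carries admissible pairs for A to admissible pairs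
    for B with the same value.  If q < 1 and H is one-dimensional, A has no such
    pairs while its radius is q|c| by convention; this number is still at most
    the radius of B, by the comparison with the quadratic form. *)
Lemma qnumradius_isometry (R : realType) (H K : hilbertType R) (q : R)
    (A : {linear H -> H}) (B : {linear K -> K}) (J : {linear H -> K}) :
  0 < q <= 1 -> bounded_near B (nbhs (0 : K)) ->
  (forall x y, inner (J x) (J y) = inner x y) ->
  (forall x, B (J x) = J (A x)) ->
  qnumradius q A <= qnumradius q B.
Proof.
move=> q01 Bb Jiso BJ.
have Jnorm x : `|J x| = `|x|.
  by apply/eqP; rewrite -(@eqrXn2 _ 2)// !sqr_norm_inner Jiso.
apply: qnumradius_le => [|r]; first exact: qnumradius_ge0.
rewrite {1}/qnummoduli; case: ifPn => [/asboolP[[e e0 _] _] [c cA rE]|/asboolPn nd].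
- have := quadratic_le_qnumradius (J e) q01 Bb.
  rewrite BJ Jiso cA innerZl Jnorm -sqr_norm_inner normrM.
  rewrite [`|_ ^+ 2|]ger0_norm ?exprn_ge0// mulrA ler_pM2r.
    by rewrite -rE lecR.
  by rewrite exprn_gt0// normr_gt0.
- move=> [z [x [y [x1 y1 xy ->]]] rE]; apply: le_qnumradius Bb _.
  rewrite /qnummoduli asboolF.
    exists (inner (A x) y) => //; exists (J x), (J y).
    by split; rewrite ?Jnorm ?BJ ?Jiso.
  (* a one-dimensional K would force the nonzero space H to be a line as well *)
  move=> [[e e0 eK] q1]; apply: nd; split=> //; exists x.
    by rewrite -normr_eq0 x1 oner_eq0.
  have [a aE] := eK (J x).
  have a0 : a != 0.
    apply: contra_eq_neq x1 => a0.
    by rewrite -Jnorm aE a0 scale0r normr0 eq_sym oner_neq0.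
  move=> v; have [b bE] := eK (J v); exists (b / a).
  apply/eqP; rewrite -subr_eq0 -normr_eq0 -Jnorm linearB linearZ/= bE aE.
  by rewrite scalerA divfK// subrr normr0.
Qed.

(** * Orthonormal eigenvectors of the path *)

Section SineBasis.
Variable R : realType.

Definition path_adj n : 'M[R]_n :=
  \matrix_(i, j) ((i.+1 == j :> nat) || (j.+1 == i :> nat))%:R.

Lemma path_adj_sym n : (path_adj n)^T = path_adj n.
Proof. by apply/matrixP => i j; rewrite !mxE orbC. Qed.

(** The boundary conditions f 0 = f (n + 1) = 0 let the two end vertices be
    treated as if they had two neighbours; vertex i carries the value f (i + 1),
    which leaves room for the fictitious vertex on the left. *)
Lemma sum_path_adj n (f : nat -> R) (j : 'I_n) : f 0%N = 0 -> f n.+1 = 0 ->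
  \sum_(i < n) f i.+1 * path_adj n i j = f j + f j.+2.
Proof.
move=> f0 fn.
have pick m (g : nat -> R) l : (l < m)%N -> \sum_(i < m) g i * (i == l :> nat)%:R = g l.
  move=> lm; rewrite (bigD1 (Ordinal lm))//= eqxx mulr1 big1 ?addr0// => i.
  by rewrite -val_eqE/= => /negbTE->; rewrite mulr0.
rewrite -(pick n.+1 f j) ?(ltnW (ltn_ord j))//; last first.
  by rewrite ltnS ltnW.
rewrite -(pick n.+1 (fun i => f i.+1) j.+1) ?ltnS//.
rewrite big_ord_recl big_ord_recr/= f0 fn !mul0r add0r addr0 -big_split/=.
apply: eq_bigr => i _; rewrite mxE -mulrDr -natrD; congr (_ * _%:R).
rewrite /bump/= add1n [j.+1 == _]eq_sym.
have [<-|_] := eqVneq i.+1 (j : nat); last by case: (_ == _).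
by rewrite (ltn_eqF (leqnSn i.+1)).
Qed.

Definition path_angle n (k : nat) : R := k%:R * pi / n.+1%:R.

(** This is sin (a - t) + sin (a + t) = 2 cos t sin a; the choice of the angle t
    makes the sine vanish at the fictitious vertex n + 1. *)
Lemma path_adj_sine n (k : nat) :
  (\row_(j < n) sin (j.+1%:R * path_angle n k)) *m path_adj n =
  (2 * cos (path_angle n k)) *: (\row_j sin (j.+1%:R * path_angle n k)).
Proof.
apply/rowP => j; rewrite !mxE.
under eq_bigr do rewrite mxE.
rewrite (@sum_path_adj n (fun j => sin (j%:R * path_angle n k))).
- have -> : j%:R * path_angle n k = j.+1%:R * path_angle n k - path_angle n k.
    by rewrite -natr1; ring.
  have -> : j.+2%:R * path_angle n k = j.+1%:R * path_angle n k + path_angle n k.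
    by rewrite -[j.+2%:R]natr1; ring.
  by rewrite sinB sinD; ring.
- by rewrite mul0r sin0.
- rewrite /path_angle mulrC divfK// ?pnatr_eq0//.
  by elim: k => [|k IH]; rewrite ?mul0r ?sin0// -natr1 mulrDl mul1r sinDpi IH oppr0.
Qed.

Lemma angle_itv n (k : 'I_n) : 0 < path_angle n k.+1 < pi.
Proof.
rewrite /path_angle divr_gt0 ?mulr_gt0 ?pi_gt0//=.
by rewrite ltr_pdivrMr// mulrC ltr_pM2l ?pi_gt0// ltr_nat ltnS.
Qed.

Lemma cos_angle_inj n : injective (fun k : 'I_n => cos (path_angle n k.+1)).
Proof.
move=> k l /cos_inj.
have ai (m : 'I_n) : path_angle n m.+1 \in `[0, pi].
  by have /andP[a0 a1] := angle_itv m; rewrite in_itv/= !ltW.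
rewrite !ai => /(_ isT isT); rewrite /path_angle => /mulIf.
rewrite invr_eq0 pnatr_eq0 => /(_ isT) /mulIf; rewrite gt_eqF ?pi_gt0//.
by move=> /(_ isT) /eqP; rewrite eqr_nat eqSS => /eqP/val_inj.
Qed.

(** Orthogonality needs no trigonometric sums: the matrix is symmetric and its n
    eigenvalues are distinct, since the cosine is injective on [0, pi].  The
    squared norms are left unevaluated; they are positive because the first
    coordinate sin (k pi / (n + 1)) of each eigenvector is. *)
Lemma path_adj_orthonormal_eigenbasis n : exists2 Q : 'M[R]_n, Q *m Q^T = 1%:M &
  forall k, row k Q *m path_adj n = (2 * cos (path_angle n k.+1)) *: row k Q.
Proof.
pose V := \matrix_(k < n) (\row_(j < n) sin (j.+1%:R * path_angle n k.+1)).
have rowV k : row k V = \row_(j < n) sin (j.+1%:R * path_angle n k.+1) by rewrite rowK.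
pose ev (k : 'I_n) := 2 * cos (path_angle n k.+1).
have eigV k : row k V *m path_adj n = ev k *: row k V.
  by rewrite rowV path_adj_sine.
pose g k l := (row k V *m (row l V)^T) 0 0.
have gE k l : g k l = \sum_j V k j * V l j.
  by rewrite /g mxE; apply: eq_bigr => j _; rewrite !mxE.
have g_off k l : k != l -> g k l = 0.
  move=> kl.
  have comm : ev k *: (row k V *m (row l V)^T) = ev l *: (row k V *m (row l V)^T).
    rewrite scalemxAl -eigV scalemxAr -linearZ/= -eigV.
    by rewrite trmx_mul path_adj_sym mulmxA.
  have := congr1 (fun B : 'M_1 => B 0 0) comm; rewrite [LHS]mxE [RHS]mxE -/(g k l).
  move/eqP; rewrite -subr_eq0 -mulrBl mulf_eq0 => /orP[|/eqP//].
  rewrite /ev -mulrBr mulf_eq0 pnatr_eq0/= subr_eq0 => /eqP/cos_angle_inj.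
  by move=> kl'; rewrite kl' eqxx in kl.
have g_gt0 k : 0 < g k k.
  have n0 : (0 < n)%N by exact: leq_ltn_trans (leq0n k) (ltn_ord k).
  rewrite gE (bigD1 (Ordinal n0))//= ltr_pwDl//; last first.
    by apply: sumr_ge0 => j _; rewrite -expr2 sqr_ge0.
  by rewrite !mxE/= mul1r mulr_gt0// sin_gt0_pi// angle_itv.
exists (\matrix_k ((Num.sqrt (g k k))^-1 *: row k V)).
  apply/matrixP => k l; rewrite [LHS]mxE [RHS]mxE.
  transitivity ((Num.sqrt (g k k))^-1 * (Num.sqrt (g l l))^-1 * g k l).
    rewrite (gE k l) mulr_sumr; apply: eq_bigr => j _.
    by rewrite !mxE; ring.
  have [<-|kl] := eqVneq k l; last by rewrite (g_off k l)// mulr0.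
  rewrite -invfM -expr2 sqr_sqrtr ?ltW// mulVf// gt_eqF//.
by move=> k; rewrite rowK -scalemxAl eigV !scalerA mulrC.
Qed.

End SineBasis.

(** * Diagonalization of the tridiagonal operator matrix *)

Section Modes.
Variables (R : realType) (n : nat) (H : hilbertType R).
Implicit Types (v w : 'rV[R]_n) (x y : H) (T S : {linear H -> H}).

(** The elementary tensor of v and x, in the identification of the direct sum
    with the tensor product of the scalar n-space and H. *)
Definition mode v x : hsum n H := [ffun j => (v 0 j)%:C *: x].

Fact mode_linear v : linear (mode v).
Proof.
move=> a x y; apply/ffunP => j; rewrite !ffunE scalerDr; congr (_ + _).
by rewrite !scalerA mulrC.
Qed.

HB.instance Definition _ v :=
  @GRing.isLinear.Build _ _ _ _ (mode v) (mode_linear v).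

Lemma inner_mode v w x y :
  inner (mode v x) (mode w y) = ((v *m w^T) 0 0)%:C * inner x y.
Proof.
rewrite mxE rmorph_sum mulr_suml /inner/= /hsum_inner; apply: eq_bigr => j _.
by rewrite !ffunE innerZl innerZr_real mulrA mxE rmorphM.
Qed.

Lemma tridiag_mode v (l : R) T S x : v *m path_adj R n = l *: v ->
  opmx (tridiag n T S) (mode v x) = mode v ((T \+ l%:C \*: S) x).
Proof.
move=> vl; apply/ffunP => i; rewrite !ffunE/=.
have entry j : tridiag n T S i j ((v 0 j)%:C *: x) =
    (if j == i then (v 0 j)%:C *: T x else 0)
    + (v 0 j * path_adj R n j i)%:C *: S x.
  rewrite !mxE eq_sym [(_ == i :> nat) || _]orbC.
  have [->|ji] := eqVneq j i.
    rewrite linearZ/= gtn_eqF//= mulr0 scale0r addr0//.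
  rewrite add0r; case: ifP => _; first by rewrite linearZ/= mulr1.
  by rewrite mulr0 scale0r.
under eq_bigr do rewrite ffunE entry.
rewrite big_split/= -big_mkcond big_pred1_eq -scaler_suml -rmorph_sum.
have := congr1 (fun B : 'rV_n => B 0 i) vl; rewrite !mxE => ->.
by rewrite scalerDr scalerA mulrC rmorphM.
Qed.

Lemma inner_modes (Q : 'M[R]_n) k l x y : Q *m Q^T = 1%:M ->
  inner (mode (row k Q) x) (mode (row l Q) y) = (k == l)%:R * inner x y.
Proof.
move=> QQ; rewrite inner_mode; congr (_ * _).
have -> : (row k Q *m (row l Q)^T) 0 0 = (Q *m Q^T) k l.
  by rewrite !mxE; apply: eq_bigr => j _; rewrite !mxE.
by rewrite QQ mxE rmorph_nat.
Qed.

Lemma inner_sum_modes (Q : 'M[R]_n) (a b : 'I_n -> H) : Q *m Q^T = 1%:M ->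
  inner (\sum_k mode (row k Q) (a k)) (\sum_k mode (row k Q) (b k)) =
  \sum_k inner (a k) (b k).
Proof.
move=> QQ; rewrite linear_sumlz; apply: eq_bigr => k _.
rewrite linear_sumr (bigD1 k)//= inner_modes// eqxx mul1r big1 ?addr0// => l lk.
by rewrite inner_modes// eq_sym (negbTE lk) mul0r.
Qed.

(** Completeness: Q is square, so orthonormal rows give orthonormal columns. *)
Lemma mode_decomposition (Q : 'M[R]_n) (u : hsum n H) : Q *m Q^T = 1%:M ->
  u = \sum_k mode (row k Q) (\sum_j (Q k j)%:C *: u j).
Proof.
move=> QQ; apply/ffunP => i; rewrite sum_ffunE.
under eq_bigr do rewrite ffunE mxE scaler_sumr.
rewrite exchange_big/=.
have QtQ : Q^T *m Q = 1%:M by exact: mulmx1C.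
have entry j : \sum_k (Q k i)%:C *: ((Q k j)%:C *: u j) = (i == j)%:R *: u j.
  under eq_bigr do rewrite scalerA -rmorphM.
  rewrite -scaler_suml -rmorph_sum; congr (_ *: _).
  have := congr1 (fun B : 'M_n => B i j) QtQ; rewrite !mxE.
  under eq_bigr do rewrite mxE.
  by move=> ->; rewrite rmorph_nat.
under eq_bigr do rewrite entry.
rewrite (bigD1 i)//= eqxx scale1r big1 ?addr0// => j ji.
by rewrite eq_sym (negbTE ji) scale0r.
Qed.

End Modes.

(** * Comparison of the radii *)

Theorem theorem3p1 (R : realType) (H : hilbertType R) (T S : {linear H -> H})
  (T_bounded : bounded_near T (nbhs (0 : H)))
  (S_bounded : bounded_near S (nbhs (0 : H)))
  (q : R) (q_gt0 : 0 < q) (q_le1 : q <= 1) (n : nat) (n_gt0 : (0 < n)%N) :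
  let M : R := \big[Num.max/0]_(1 <= k < n.+1)
    qnumradius q (T \+ (2 * cos (k%:R * pi / n.+1%:R))%:C \*: S) in
  M <= qnumradius (K := hsum n H) q (opmx (tridiag n T S))
    <= (q + 2 * Num.sqrt (1 - q ^+ 2)) / q * M.
Proof.
rewrite big_add1/= big_mkord; set M := \big[_/_]_(i < n) _.
have q01 : 0 < q <= 1 by rewrite q_gt0.
have [Q QQ eigQ] := path_adj_orthonormal_eigenbasis R n.
pose A (k : 'I_n) := T \+ (2 * cos (path_angle R n k.+1))%:C \*: S.
have PQ k x : opmx (tridiag n T S) (mode (row k Q) x) = mode (row k Q) (A k x).
  by apply: tridiag_mode; exact: eigQ.
have P_bounded : bounded_near (opmx (tridiag n T S)) (nbhs (0 : hsum n H)).
  apply: opmx_bounded => i j; rewrite mxE; case: ifP => _ //; case: ifP => _ //.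
  by apply/bounded_nearP; exists 0 => // x; rewrite normr0 mul0r.
have A_bounded k : bounded_near (A k) (nbhs (0 : H)).
  exact: bounded_near_addZ.
have M0 : 0 <= M by exact: bigmax_ge_id.
have AM k : qnumradius q (A k) <= M.
  exact: (le_bigmax 0 (fun k : 'I_n => qnumradius q (A k))).
apply/andP; split.
  apply: bigmax_le => [|k _]; first exact: qnumradius_ge0.
  apply: (@qnumradius_isometry _ _ _ _ _ _ (mode (row k Q)) q01 P_bounded _ (PQ k)).
  by move=> x y; rewrite inner_modes// eqxx mul1r.
have -> : (q + 2 * Num.sqrt (1 - q ^+ 2)) / q * M =
  (q + 2 * Num.sqrt (1 - q ^+ 2)) * (M / q) by rewrite mulrAC mulrA.
apply: qnumradius_le_of_quadratic => // [|v]; first by rewrite divr_ge0// ltW.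
pose u k := \sum_j (Q k j)%:C *: v j.
have vE : v = \sum_k mode (row k Q) (u k) by exact: mode_decomposition.
have PvE : opmx (tridiag n T S) v = \sum_k mode (row k Q) (A k (u k)).
  by rewrite [X in opmx _ X]vE linear_sum; apply: eq_bigr => k _; exact: PQ.
rewrite /= PvE sqr_norm_inner [in leRHS]vE [in leLHS]vE !inner_sum_modes// mulr_sumr.
apply: le_trans (ler_norm_sum _ _ _) _; apply: ler_sum => k _.
have qC0 : 0 < q%:C by rewrite ltcR.
rewrite -(ler_pM2l qC0) mulrA.
have -> : q%:C * (M / q)%:C = M%:C by rewrite -rmorphM/= mulrC divfK ?gt_eqF.
apply: le_trans (quadratic_le_qnumradius _ q01 (A_bounded k)) _.
by rewrite sqr_norm_inner ler_wpM2r ?dnorm_ge0 ?lecR ?AM.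
Qed.
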